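(* The Lie group $E_{6,\mathbb{R}}$ is isomorphic to the Lie group $SU(3)$: $E_{6,\mathbb{R}}\cong SU(3)$.
   Context: Let $(\mathfrak{J}_{\mathbb{R}})^{\mathbb{C}}$ be the 6-dimensional complex vector space of symmetric $3\times 3$ complex matrices, $\det$ the determinant on it, $(X,Y)=\mathrm{tr}(X\circ Y)$ with $X\circ Y=\frac12(XY+YX)$, $\tau$ the entrywise complex conjugation, and $\langle X,Y\rangle=(\tau X,Y)$ the Hermitian inner product. Define $E_{6,\mathbb{R}}=\{\alpha\in \mathrm{Iso}_{\mathbb{C}}((\mathfrak{J}_{\mathbb{R}})^{\mathbb{C}}) \mid \det(\alpha X)=\det X,\ \langle\alpha X,\alpha Y\rangle=\langle X,Y\rangle \text{ for all } X,Y\}$, where $\mathrm{Iso}_{\mathbb{C}}(V)$ denotes the group of $\mathbb{C}$-linear automorphisms of $V$. *)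

(* Defs.v *)
From HB Require Import structures.
From mathcomp Require Import all_boot all_order all_algebra.
From mathcomp Require Import complex.
From mathcomp Require Import all_classical all_reals all_analysis.

Set Implicit Arguments.
Unset Strict Implicit.
Unset Printing Implicit Defensive.

Import Order.TTheory GRing.Theory Num.Theory.
Import numFieldNormedType.Exports.

Local Open Scope classical_set_scope.
Local Open Scope ring_scope.

Section LinearAutomorphisms.
Variables (K : fieldType) (V : vectType K).

Record linaut := LinAut { linaut_val :> 'End(V); _ : lker linaut_val == 0%VS }.

HB.instance Definition _ := [isSub for linaut_val].
HB.instance Definition _ := [Choice of linaut by <:].

Lemma linaut_ker (a : linaut) : lker a == 0%VS. Proof. by case: a. Qed.

Fact linaut1_subproof : lker (\1%VF : 'End(V)) == 0%VS.
Proof. by apply/lker0P => x y; rewrite !id_lfunE. Qed.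

Fact linautM_subproof (a b : linaut) : lker (a \o b)%VF == 0%VS.
Proof.
by apply/lker0P => x y; rewrite !comp_lfunE => /(lker0P (linaut_ker a))
  /(lker0P (linaut_ker b)).
Qed.

Fact linautV_subproof (a : linaut) : lker (a^-1)%VF == 0%VS.
Proof.
apply/lker0P => x y e.
by rewrite -(lker0_lfunVK (linaut_ker a) x) e (lker0_lfunVK (linaut_ker a)).
Qed.

Definition linaut1 := LinAut linaut1_subproof.
Definition linautM a b := LinAut (linautM_subproof a b).
Definition linautV a := LinAut (linautV_subproof a).

Fact linautMA : associative linautM.
Proof. by move=> a b c; apply: val_inj; rewrite /= comp_lfunA. Qed.
Fact linaut1M : left_id linaut1 linautM.
Proof. by move=> a; apply: val_inj; rewrite /= comp_lfun1l. Qed.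
Fact linautM1 : right_id linaut1 linautM.
Proof. by move=> a; apply: val_inj; rewrite /= comp_lfun1r. Qed.
Fact linautVM : left_inverse linaut1 linautV linautM.
Proof. by move=> a; apply: val_inj; rewrite /= lker0_compVf ?linaut_ker. Qed.
Fact linautMV : right_inverse linaut1 linautV linautM.
Proof. by move=> a; apply: val_inj; rewrite /= lker0_compfV ?linaut_ker. Qed.

HB.instance Definition _ :=
  isGroup.Build linaut linautMA linaut1M linautM1 linautVM linautMV.

End LinearAutomorphisms.

Section Smooth.
Variable R : realType.

(* For open [U]: existence and continuity on [U] of all iterated directional
   derivatives up to order [k]; nothing is required of [f] outside [U]. *)
Fixpoint Ck m n (k : nat) (U : set 'rV[R]_m) (f : 'rV[R]_m -> 'rV[R]_n)
    : Prop :=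
  (forall x, U x -> {for x, continuous f}) /\
  if k is k'.+1 then
    forall v, (forall x, U x -> derivable f x v) /\ Ck k' U ('D_v f)
  else True.

Definition smooth_on m n (U : set 'rV[R]_m) (f : 'rV[R]_m -> 'rV[R]_n) : Prop :=
  open U /\ forall k, Ck k U f.

(* Real coordinates on a finite-dimensional complex vector space, in the
   library's chosen basis; the topology and the smooth functions they induce do
   not depend on that choice. *)
Definition realcoord (V : vectType R[i]) (v : V)
    : 'rV[R]_(\dim {:V} + \dim {:V}) :=
  row_mx (\row_i complex.Re (coord (vbasis {:V}) i v))
         (\row_i complex.Im (coord (vbasis {:V}) i v)).

(* A closed subgroup of GL(V), given by a faithful representation whose image
   is closed in GL(V). By Cartan's theorem it is an embedded submanifold of the
   real vector space End(V), and its Lie group structure is the one induced. *)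
Record linear_lie_group := LinearLieGroup {
  lie_sort :> groupType;
  lie_space : vectType R[i];
  lie_rep : {multiplicative lie_sort -> linaut lie_space};
  lie_rep_inj : injective lie_rep;
  lie_rep_closed : forall u : linaut lie_space,
    closure (range (fun x : lie_sort => realcoord (linaut_val (lie_rep x))))
      (realcoord (linaut_val u)) ->
    range lie_rep u
}.

Definition lie_coord (G : linear_lie_group) (x : G) :=
  realcoord (linaut_val (lie_rep G x)).

(* Smoothness of a map between embedded submanifolds: around every point it is
   the restriction of a smooth map defined on an open subset of the ambient
   vector space. *)
Definition lie_smooth (G H : linear_lie_group) (f : G -> H) : Prop :=
  forall x : G, exists U F,
    [/\ smooth_on U F, U (lie_coord x) &
        forall y : G, U (lie_coord y) -> lie_coord (f y) = F (lie_coord y)].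

Definition lie_isomorphic (G H : linear_lie_group) : Prop :=
  exists (f : {multiplicative G -> H}) (g : H -> G),
    [/\ cancel f g, cancel g f, lie_smooth f & lie_smooth g].

End Smooth.

Section Closedness.
Variable R : realType.
Local Notation C := R[i].

Definition ccont m (h : 'rV[R]_m -> C) : Prop :=
  continuous (fun w => complex.Re (h w)) /\ continuous (fun w => complex.Im (h w)).

Lemma ccont_cst m (c : C) : ccont (fun _ : 'rV[R]_m => c).
Proof. by split; apply: cst_continuous. Qed.

Lemma ccontD m (h k : 'rV[R]_m -> C) :
  ccont h -> ccont k -> ccont (fun w => h w + k w).
Proof.
move=> [h1 h2] [k1 k2]; split.
  rewrite (_ : (fun w => _) = (fun w => complex.Re (h w) + complex.Re (k w))).
    by move=> w; exact: (cvgD (h1 w) (k1 w)).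
  by apply/funext => w; case: (h w) => ? ?; case: (k w).
rewrite (_ : (fun w => _) = (fun w => complex.Im (h w) + complex.Im (k w))).
  by move=> w; exact: (cvgD (h2 w) (k2 w)).
by apply/funext => w; case: (h w) => ? ?; case: (k w).
Qed.

Lemma ccontM m (h k : 'rV[R]_m -> C) :
  ccont h -> ccont k -> ccont (fun w => h w * k w).
Proof.
move=> [h1 h2] [k1 k2]; split.
  rewrite (_ : (fun w => _) = (fun w => complex.Re (h w) * complex.Re (k w)
                                - complex.Im (h w) * complex.Im (k w))).
    by move=> w; exact: (cvgB (cvgM (h1 w) (k1 w)) (cvgM (h2 w) (k2 w))).
  by apply/funext => w; case: (h w) => ? ?; case: (k w).
rewrite (_ : (fun w => _) = (fun w => complex.Re (h w) * complex.Im (k w)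
                              + complex.Im (h w) * complex.Re (k w))).
  by move=> w; exact: (cvgD (cvgM (h1 w) (k2 w)) (cvgM (h2 w) (k1 w))).
by apply/funext => w; case: (h w) => ? ?; case: (k w).
Qed.

Lemma ccont_conj m (h : 'rV[R]_m -> C) : ccont h -> ccont (fun w => (h w)^*).
Proof.
move=> [h1 h2]; split.
  rewrite (_ : (fun w => _) = (fun w => complex.Re (h w))) //.
  by apply/funext => w; case: (h w).
rewrite (_ : (fun w => _) = (fun w => - complex.Im (h w))).
  by move=> w; exact: (cvgN (h2 w)).
by apply/funext => w; case: (h w).
Qed.

Lemma ccont_sum m (I : Type) (r : seq I) (P : pred I) (h : I -> 'rV[R]_m -> C) :
  (forall i, ccont (h i)) -> ccont (fun w => \sum_(i <- r | P i) h i w).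
Proof.
move=> hh; elim: r => [|a r IH].
  by under [X in ccont X]funext do rewrite big_nil; apply: ccont_cst.
under [X in ccont X]funext do rewrite big_cons.
by case: (P a); first apply: ccontD.
Qed.

Lemma ccont_prod m (I : Type) (r : seq I) (P : pred I) (h : I -> 'rV[R]_m -> C) :
  (forall i, ccont (h i)) -> ccont (fun w => \prod_(i <- r | P i) h i w).
Proof.
move=> hh; elim: r => [|a r IH].
  by under [X in ccont X]funext do rewrite big_nil; apply: ccont_cst.
under [X in ccont X]funext do rewrite big_cons.
by case: (P a); first apply: ccontM.
Qed.

Lemma ccont_det m n (h : 'rV[R]_m -> 'M[C]_n) :
  (forall i j, ccont (fun w => h w i j)) -> ccont (fun w => \det (h w)).
Proof.
move=> hh; rewrite /determinant; apply: ccont_sum => s.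
by apply: ccontM; [apply: ccont_cst|apply: ccont_prod].
Qed.

Definition realdecode (V : vectType C)
    (w : 'rV[R]_(\dim {:V} + \dim {:V})) : V :=
  \sum_j (w 0 (lshift _ j) +i* w 0 (rshift _ j))%C *: (vbasis {:V})`_j.

Lemma realcoordK (V : vectType C) : cancel (@realcoord R V) (@realdecode V).
Proof.
move=> v; rewrite [RHS](coord_vbasis (memvf v)); apply: eq_bigr => j _.
rewrite row_mxEl row_mxEr !mxE.
by case: (coord _ j v).
Qed.

Lemma ccont_linear (V : vectType C) (l : V -> C) : linear_for *%R l ->
  ccont (fun w => l (@realdecode V w)).
Proof.
move=> ll.
pose l' : {linear V -> C^o} := HB.pack (l : V -> C^o)
  (GRing.isLinear.Build C V C^o *:%R l ll).
have e w : l (@realdecode V w) =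
    \sum_j (w 0 (lshift _ j) +i* w 0 (rshift _ j))%C * l (vbasis {:V})`_j.
  rewrite -[LHS]/(l' _) /realdecode linear_sum.
  by apply: eq_bigr => j _; rewrite linearZ.
under [X in ccont X]funext do rewrite e.
apply: ccont_sum => j; apply: ccontM; last exact: ccont_cst.
by split=> w /=; apply: coord_continuous.
Qed.

Lemma ccont_closure m (h k : 'rV[R]_m -> C) (S : set 'rV[R]_m) x :
  ccont h -> ccont k -> (forall y, S y -> h y = k y) -> closure S x -> h x = k x.
Proof.
move=> [h1 h2] [k1 k2] hk Sx.
have cl (a b : 'rV[R]_m -> R) : continuous a -> continuous b ->
    (forall y, S y -> a y = b y) -> a x = b x.
  move=> ca cb ab; apply/eqP; rewrite -subr_eq0; apply/eqP.
  have cd : continuous (fun w => a w - b w).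
    by move=> w; exact: (cvgB (ca w) (cb w)).
  have : closed ((fun w => a w - b w) @^-1` [set 0]).
    apply: closed_comp; last exact: closed_eq.
    by move=> w _; apply: cd.
  apply; apply: closure_subset Sx => y Sy /=.
  by rewrite ab // subrr.
have := cl _ _ h1 k1 (fun y Sy => congr1 (@complex.Re R) (hk y Sy)).
have := cl _ _ h2 k2 (fun y Sy => congr1 (@complex.Im R) (hk y Sy)).
by case: (h x) => ? ?; case: (k x) => ? ? /= -> ->.
Qed.

End Closedness.

Section SpecialUnitary.
Variables (R : realType) (n : nat).
Local Notation C := R[i].

Record SU_sort := MkSU {
  SU_val :> 'M[C]_n;
  _ : (SU_val \is unitarymx) && (\det SU_val == 1) }.

HB.instance Definition _ := [isSub for SU_val].
HB.instance Definition _ := [Choice of SU_sort by <:].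

Lemma SU_unitary (A : SU_sort) : (A : 'M[C]_n) \is unitarymx.
Proof. by case: A => A /= /andP[]. Qed.

Lemma SU_det (A : SU_sort) : \det A = 1.
Proof. by case: A => A /= /andP[_ /eqP]. Qed.

Fact SU1_subproof :
  ((1%:M : 'M[C]_n) \is unitarymx) && (\det (1%:M : 'M[C]_n) == 1).
Proof.
by rewrite det1 eqxx andbT; apply/unitarymxP; rewrite trmx1 map_mx1 mul1mx.
Qed.

Fact SUM_subproof (A B : SU_sort) :
  ((A *m B : 'M[C]_n) \is unitarymx) && (\det (A *m B : 'M[C]_n) == 1).
Proof. by rewrite mul_unitarymx ?SU_unitary //= det_mulmx !SU_det mul1r. Qed.

Fact SUV_subproof (A : SU_sort) :
  ((invmx A : 'M[C]_n) \is unitarymx) && (\det (invmx A : 'M[C]_n) == 1).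
Proof.
rewrite det_inv SU_det invr1 eqxx andbT invmx_unitary ?SU_unitary //.
by rewrite trmxC_unitary SU_unitary.
Qed.

Definition SU1 := MkSU SU1_subproof.
Definition SUM A B := MkSU (SUM_subproof A B).
Definition SUV A := MkSU (SUV_subproof A).

Lemma SU_unit (A : SU_sort) : (A : 'M[C]_n) \in unitmx.
Proof. exact/unitarymx_unit/SU_unitary. Qed.

Fact SUMA : associative SUM.
Proof. by move=> A B D; apply: val_inj; rewrite /= mulmxA. Qed.
Fact SU1M : left_id SU1 SUM.
Proof. by move=> A; apply: val_inj; rewrite /= mul1mx. Qed.
Fact SUM1 : right_id SU1 SUM.
Proof. by move=> A; apply: val_inj; rewrite /= mulmx1. Qed.
Fact SUVM : left_inverse SU1 SUV SUM.
Proof. by move=> A; apply: val_inj; rewrite /= mulVmx ?SU_unit. Qed.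
Fact SUMV : right_inverse SU1 SUV SUM.
Proof. by move=> A; apply: val_inj; rewrite /= mulmxV ?SU_unit. Qed.

HB.instance Definition _ := isGroup.Build SU_sort SUMA SU1M SUM1 SUVM SUMV.

Fact SU_rep_subproof (A : SU_sort) :
  lker (linfun (mulmx A) : 'End('cV[C]_n)) == 0%VS.
Proof.
apply/lker0P => x y; rewrite !lfunE /= => e.
by rewrite -(mulKmx (SU_unit A) x) e mulKmx ?SU_unit.
Qed.

Definition SU_rep (A : SU_sort) : linaut 'cV[C]_n := LinAut (SU_rep_subproof A).

Fact SU_repM : {morph SU_rep : A B / (A * B)%g}.
Proof.
move=> A B; apply: val_inj; apply/lfunP => x.
by rewrite /= comp_lfunE !lfunE /= mulmxA.
Qed.

HB.instance Definition _ := isMultiplicative.Build _ _ SU_rep SU_repM.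

Fact SU_rep_inj : injective SU_rep.
Proof.
move=> A B e; apply: val_inj; apply/matrixP => i j.
have /lfunP/(_ (delta_mx j 0)) := congr1 (@linaut_val _ _) e.
by rewrite !lfunE /= -!colE => /matrixP/(_ i 0); rewrite !mxE.
Qed.

Fact SU_rep_closed (u : linaut 'cV[C]_n) :
  closure (range (fun A => realcoord (linaut_val (SU_rep A))))
    (realcoord (linaut_val u)) -> range SU_rep u.
Proof.
move=> cu.
pose M (a : 'End('cV[C]_n)) : 'M[C]_n := \matrix_(i, j) a (delta_mx j 0) i 0.
have cM i j : ccont (fun w => M (realdecode w) i j).
  under [X in ccont X]funext do rewrite mxE.
  apply: (ccont_linear (l := fun a : 'End('cV[C]_n) => a (delta_mx j 0) i 0)).
  by move=> c a b; rewrite add_lfunE scale_lfunE !mxE.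
have M_rep A : M (SU_rep A) = A.
  by apply/matrixP => i j; rewrite mxE /= lfunE /= -colE mxE.
have M_SU : (M u \is unitarymx) && (\det (M u) == 1).
  apply/andP; split; last first.
    apply/eqP; rewrite -[linaut_val u]realcoordK.
    apply: (ccont_closure (ccont_det cM) (ccont_cst _ 1)) cu => _ [A _ <-].
    by rewrite realcoordK M_rep SU_det.
  apply/unitarymxP/matrixP => i j; rewrite -[linaut_val u]realcoordK.
  apply: (ccont_closure (h := fun w => (M (realdecode w) *m
    map_mx Num.conj (M (realdecode w))^T) i j) _ (ccont_cst _ _)) cu.
    under [X in ccont X]funext do rewrite mxE.
    apply: ccont_sum => k; apply: ccontM => //.
    under [X in ccont X]funext do rewrite mxE mxE.
    exact: ccont_conj.
  by move=> _ [A _ <-]; rewrite realcoordK M_rep (unitarymxP (SU_unitary A)).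
exists (MkSU M_SU) => //; apply: val_inj; apply/lfunP => x /=.
rewrite lfunE /= [in RHS](matrix_sum_delta x) linear_sum.
apply/colP => i; rewrite !mxE summxE; apply: eq_bigr => j _.
by rewrite big_ord1 linearZ !mxE mulrC.
Qed.

(* SU(n) with its natural representation on C^n. *)
Definition SU : linear_lie_group R := LinearLieGroup SU_rep_inj SU_rep_closed.

End SpecialUnitary.

Section E6R.
Variable R : realType.
Local Notation C := R[i].

Definition symmx : {vspace 'M[C]_3} := fixedSpace (linfun trmx).

Lemma mem_symmx (X : 'M[C]_3) : (X \in symmx) = (X^T == X).
Proof. by apply/fixedSpaceP/eqP; rewrite lfunE. Qed.

Definition JRC := subvs_of symmx.

Definition jordan (X Y : 'M[C]_3) : 'M[C]_3 := 2^-1 *: (X *m Y + Y *m X).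

Definition trform (X Y : 'M[C]_3) : C := \tr (jordan X Y).

Definition tau (X : 'M[C]_3) : 'M[C]_3 := map_mx Num.conj X.

Definition herm (X Y : JRC) : C := trform (tau (vsval X)) (vsval Y).

Definition E6R_pred (a : linaut JRC) : bool :=
  `[< (forall X, \det (vsval (a X)) = \det (vsval X)) /\
      (forall X Y, herm (a X) (a Y) = herm X Y) >].

Record E6R_sort := MkE6R { E6R_val :> linaut JRC; _ : E6R_pred E6R_val }.

HB.instance Definition _ := [isSub for E6R_val].
HB.instance Definition _ := [Choice of E6R_sort by <:].

Lemma E6RP (a : linaut JRC) : reflect
  ((forall X, \det (vsval (a X)) = \det (vsval X)) /\
   (forall X Y, herm (a X) (a Y) = herm X Y)) (E6R_pred a).
Proof. exact: asboolP. Qed.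

Fact E6R_group_closed : group_closed E6R_pred.
Proof.
split=> [|a b /E6RP[da ha] /E6RP[db hb]]; apply/E6RP.
  by split=> *; rewrite !id_lfunE.
have Kb X : b ((b^-1)%g X) = X by apply: (lker0_lfunVK (linaut_ker b)).
split=> [X|X Y]; rewrite !comp_lfunE.
  by rewrite da -db Kb.
by rewrite ha -hb !Kb.
Qed.

HB.instance Definition _ :=
  SubChoice_isSubGroup.Build (linaut JRC) E6R_pred E6R_sort E6R_group_closed.

Fact E6R_val_closed (u : linaut JRC) :
  closure (range (fun a : E6R_sort => realcoord (linaut_val (val a))))
    (realcoord (linaut_val u)) -> range (val : E6R_sort -> linaut JRC) u.
Proof.
move=> cu.
have c_app X i j : ccont (fun w =>
    vsval ((realdecode w : 'End(JRC)) X) i j).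
  apply: (ccont_linear (l := fun a : 'End(JRC) => vsval (a X) i j)).
  by move=> c a b; rewrite add_lfunE scale_lfunE linearP !mxE.
have c_mul (h k : 'rV[R]_(\dim {:'End(JRC)} + \dim {:'End(JRC)}) -> 'M[C]_3) :
    (forall i j, ccont (fun w => h w i j)) ->
    (forall i j, ccont (fun w => k w i j)) ->
    forall i j, ccont (fun w => (h w *m k w) i j).
  move=> ch ck i j; under [X in ccont X]funext do rewrite mxE.
  by apply: ccont_sum => l; apply: ccontM.
suff u_E6R : E6R_pred u by exists (MkE6R u_E6R) => //; exact: val_inj.
apply/E6RP; split=> [X|X Y]; rewrite -[linaut_val u]realcoordK.
  apply: (ccont_closure (ccont_det (c_app X)) (ccont_cst _ _)) cu => _ [a _ <-].
  by rewrite realcoordK; have /E6RP[] := valP a.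
apply: (ccont_closure (h := fun w => herm ((realdecode w : 'End(JRC)) X)
  ((realdecode w : 'End(JRC)) Y)) _ (ccont_cst _ _)) cu.
  have c_tau i j : ccont (fun w =>
      tau (vsval ((realdecode w : 'End(JRC)) X)) i j).
    by under [X in ccont X]funext do rewrite mxE; apply: ccont_conj.
  rewrite /herm /trform /jordan /mxtrace; apply: ccont_sum => i.
  under [X in ccont X]funext do rewrite mxE mxE.
  by apply: ccontM; [exact: ccont_cst|apply: ccontD; exact: c_mul].
by move=> _ [a _ <-]; rewrite realcoordK; have /E6RP[] := valP a.
Qed.

(* E6R with its defining inclusion in Iso_C(JRC). *)
Definition E6R : linear_lie_group R :=
  LinearLieGroup (@val_inj _ _ E6R_sort) E6R_val_closed.

End E6R.

(* Main.v *)
(* The isomorphism sends A in SU(3) to X |-> A X A^T.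

   Surjectivity.  Let f preserve det and the Hermitian form.  The second
   difference of s |-> det (W + s E_kk) vanishes for every symmetric W, hence so
   does that of s |-> det (W + s f(E_kk)); this forces the 2x2 minors of f(E_kk)
   to vanish, and f(E_kk) = a_k a_k^T.  Preservation of the Hermitian form makes
   (a_k) orthonormal, so up to X |-> U X U^T with U unitary one may assume that
   f fixes every E_kk.  Then det and the norm force f(E_ij + E_ji) to be
   +-(E_ij + E_ji), and det of the matrix with zero diagonal and ones elsewhere
   shows that the product of the three signs is 1, so that f is conjugation by a
   diagonal matrix of signs.

   Smoothness.  The inverse is a real polynomial map: if w(M) is the axial
   vector of the antisymmetric part of M, then
   w(conj(A) M conj(A)^T) = A w(M) for A in SU(3).  Since e_q = w(Y 1 Z) for
   suitable real symmetric Y and Z, column q of A is w(conj(f Y) (f 1) conj(f Z)).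
*)
From HB Require Import structures.
Require Import Defs.
From mathcomp Require Import all_boot all_order all_algebra.
From mathcomp Require Import all_classical all_reals all_analysis.
From mathcomp Require Import complex ring.

Set Implicit Arguments.
Unset Strict Implicit.
Unset Printing Implicit Defensive.

Import Order.TTheory GRing.Theory Num.Theory.
Import numFieldNormedType.Exports.

Local Open Scope ring_scope.

(** * Indices, determinants and rank-one matrices in dimension three *)

Local Notation o0 := (@Ordinal 3 0 isT).
Local Notation o1 := (@Ordinal 3 1 isT).
Local Notation o2 := (@Ordinal 3 2 isT).

Lemma ord3_ind (P : 'I_3 -> Prop) : P o0 -> P o1 -> P o2 -> forall i, P i.
Proof.
move=> P0 P1 P2 [[|[|[|//]]] lti].
- by rewrite (_ : Ordinal lti = o0)//; apply: val_inj.
- by rewrite (_ : Ordinal lti = o1)//; apply: val_inj.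
- by rewrite (_ : Ordinal lti = o2)//; apply: val_inj.
Qed.

Lemma sum3E (V : nmodType) (F : 'I_3 -> V) : \sum_i F i = F o0 + F o1 + F o2.
Proof.
rewrite !big_ord_recl big_ord0 addr0 addrA.
by congr (F _ + F _ + F _); apply: val_inj.
Qed.

Lemma det3E (K : comNzRingType) (A : 'M[K]_3) : \det A =
    A o0 o0 * A o1 o1 * A o2 o2 + A o0 o1 * A o1 o2 * A o2 o0
  + A o0 o2 * A o1 o0 * A o2 o1 - A o0 o0 * A o1 o2 * A o2 o1
  - A o0 o1 * A o1 o0 * A o2 o2 - A o0 o2 * A o1 o1 * A o2 o0.
Proof.
(* Natural-number indices let computation identify the ordinals that [lift] produces in the
   cofactors, whatever their bound proofs. *)
pose a m n := A (inord m) (inord n).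
have aE i j : A i j = a i j by rewrite /a !inord_val.
rewrite (expand_det_row _ o0) sum3E /cofactor !(expand_det_row _ ord0).
rewrite !big_ord_recl !big_ord0 /cofactor !det_mx11 !mxE !aE /=.
rewrite !(expr0, expr1, exprS) /bump /=; ring.
Qed.

(** If [Z k k] is nonzero, column [k] divided by [sqrtC (Z k k)] is a witness; if the diagonal
    vanishes, the principal minors force [Z = 0]. *)
Lemma sym_rank1 (C : numClosedFieldType) n (Z : 'M[C]_n) : Z^T = Z ->
  (forall i j k, Z i j * Z k k = Z i k * Z j k) ->
  exists a : 'cV_n, Z = a *m a^T.
Proof.
move=> Zs minor0; have [k Zkk|Zd0] := pickP (fun k => Z k k != 0); last first.
  exists 0; rewrite mul0mx; apply/matrixP => i j; rewrite mxE.
  have := minor0 i i j; have /negbFE/eqP -> := Zd0 j.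
  by rewrite mulr0 => /esym/eqP; rewrite mulf_eq0 orbb => /eqP.
exists (\col_i (Z i k / sqrtC (Z k k))).
apply/matrixP => i j; rewrite mxE big_ord1 !mxE mulrACA -minor0 -invfM -expr2.
by rewrite sqrtCK mulfK.
Qed.

(** [delta_mx i i] has rank one, so the determinant is affine along its direction. *)
Lemma polar_det_diag (K : comNzRingType) (V : 'M[K]_3) i :
  \det (V + delta_mx i i) + \det (V - delta_mx i i) = 2 * \det V.
Proof.
elim/ord3_ind: i; rewrite !det3E !mxE /=; ring.
Qed.

(** For [i = j] this is twice [delta_mx i i], which gives all six test matrices of [polar_det_minor]
    the same factor. *)
Definition sym_unit (K : nzRingType) (i j : 'I_3) : 'M[K]_3 :=
  delta_mx i j + delta_mx j i.
Arguments sym_unit {K}.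

Lemma sym_unitT (K : nzRingType) (i j : 'I_3) :
  (sym_unit i j)^T = sym_unit i j :> 'M[K]_3.
Proof. by rewrite linearD /= !trmx_delta addrC. Qed.

(** The second difference exceeds zero by [2 * \tr (W *m \adj Z)], so its vanishing for all [W]
    kills every cofactor of [Z]; on each [sym_unit] it is four times one cofactor. *)
Lemma polar_det_minor (K : numFieldType) (Z : 'M[K]_3) : Z^T = Z ->
  (forall W : 'M[K]_3, W^T = W -> \det (W + Z) + \det (W - Z) = 2 * \det W) ->
  forall i j k, Z i j * Z k k = Z i k * Z j k.
Proof.
move=> Zs polar.
have s i j : Z j i = Z i j by rewrite -{1}Zs mxE.
have q i j := polar _ (sym_unitT K i j).
have H (x y l r : K) : l = r -> 4 * (x - y) = l - r -> x = y.
  by move=> -> /eqP; rewrite subrr mulf_eq0 pnatr_eq0 /= subr_eq0 => /eqP.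
pose u := (s o0 o1, s o0 o2, s o1 o2).
have m00 : Z o1 o1 * Z o2 o2 = Z o1 o2 * Z o1 o2.
  by apply: H (q o0 o0) _; rewrite !det3E !mxE /= !u; ring.
have m11 : Z o0 o0 * Z o2 o2 = Z o0 o2 * Z o0 o2.
  by apply: H (q o1 o1) _; rewrite !det3E !mxE /= !u; ring.
have m22 : Z o0 o0 * Z o1 o1 = Z o0 o1 * Z o0 o1.
  by apply: H (q o2 o2) _; rewrite !det3E !mxE /= !u; ring.
have m01 : Z o0 o2 * Z o1 o2 = Z o0 o1 * Z o2 o2.
  by apply: H (q o0 o1) _; rewrite !det3E !mxE /= !u; ring.
have m02 : Z o0 o1 * Z o1 o2 = Z o0 o2 * Z o1 o1.
  by apply: H (q o0 o2) _; rewrite !det3E !mxE /= !u; ring.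
have m12 : Z o0 o1 * Z o0 o2 = Z o1 o2 * Z o0 o0.
  by apply: H (q o1 o2) _; rewrite !det3E !mxE /= !u; ring.
elim/ord3_ind; elim/ord3_ind; elim/ord3_ind; rewrite ?u //.
all: first [exact: mulrC | by rewrite mulrC ?m00 ?m11 ?m22
           | by rewrite -?m01 -?m02 -?m12 mulrC].
Qed.

(** * Linear maps of symmetric matrices preserving the determinant and the Hermitian form *)

Section SymmetricAutomorphisms.
Variable C : numClosedFieldType.

(** On symmetric matrices the absent transpose makes no difference: this is the standard Hermitian
    form, and it agrees with [herm]. *)
Definition hermx n (X Y : 'M[C]_n) : C := \tr (map_mx Num.conj X *m Y).

Lemma hermxE n (X Y : 'M[C]_n) : hermx X Y = \sum_i \sum_j (X i j)^* * Y j i.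
Proof.
rewrite /hermx /mxtrace; apply: eq_bigr => i _; rewrite mxE.
by apply: eq_bigr => j _; rewrite mxE.
Qed.

Lemma hermx_delta n (X : 'M[C]_n) k : hermx (delta_mx k k) X = X k k.
Proof.
rewrite hermxE (bigD1 k) //= (bigD1 k) //= !mxE !eqxx conjC1 mul1r.
rewrite !big1 ?addr0 // => [i /negbTE ik|j /negbTE jk].
  by rewrite big1 // => j _; rewrite mxE ik conjC0 mul0r.
by rewrite mxE eqxx jk conjC0 mul0r.
Qed.

Lemma sym_expand (X : 'M[C]_3) : X^T = X ->
  X = \sum_k X k k *: delta_mx k k + X o0 o1 *: sym_unit o0 o1
    + X o0 o2 *: sym_unit o0 o2 + X o1 o2 *: sym_unit o1 o2.
Proof.
move=> Xs; have s i j : X j i = X i j by rewrite -{1}Xs mxE.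
rewrite sum3E; apply/matrixP; elim/ord3_ind; elim/ord3_ind; rewrite !mxE /=.
all: rewrite ?(s o0 o1) ?(s o0 o2) ?(s o1 o2); ring.
Qed.

Lemma eq0_of_normsq (x y z : C) : x ^+ 2 = 1 ->
  x^* * x + y^* * y + z^* * z = 1 -> y = 0 /\ z = 0.
Proof.
move=> x1.
have -> : x^* * x = 1.
  have: (`|x| ^+ 2) = 1 by rewrite -normrX x1 normr1.
  by rewrite normCKC.
rewrite -!normCKC => /eqP.
rewrite -subr_eq0 addrC !addrA addNr add0r paddr_eq0 ?exprn_ge0 //.
by rewrite !expf_eq0 /= !normr_eq0 => /andP[/eqP -> /eqP ->].
Qed.

(* The second premise is left to [ring]: the equation [l = r] is the only
   hypothesis needed, with coefficient 1/2. *)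
Lemma eq_of_double_diff (x y l r : C) : l = r -> 2 * (x - y) = l - r -> x = y.
Proof.
by move=> -> /eqP; rewrite subrr mulf_eq0 pnatr_eq0 /= subr_eq0 => /eqP.
Qed.

(** The determinant sum for [B] is [- 2 * B i j ^+ 2], which fixes this entry up to sign; the norm
    is twice the sum of the squared moduli above the diagonal, so this entry exhausts it. *)
Lemma sym_unit_char (B : 'M[C]_3) i j k : uniq [:: i; j; k] ->
  B^T = B -> (forall p, B p p = 0) ->
  hermx B B = hermx (sym_unit i j) (sym_unit i j) ->
  \det (delta_mx k k + B) + \det (delta_mx k k - B) =
    \det (delta_mx k k + sym_unit i j) + \det (delta_mx k k - sym_unit i j) ->
  B i j ^+ 2 = 1 /\ B = B i j *: sym_unit i j.
Proof.
move=> ijk Bs z; have s p q : B q p = B p q by rewrite -{1}Bs mxE.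
have u := (s o0 o1, s o0 o2, s o1 o2).
rewrite !hermxE !sum3E !det3E => h d.
have aa : B i j ^+ 2 = 1.
  apply: eq_of_double_diff (esym d) _; move: ijk {h d}.
  elim/ord3_ind: i; elim/ord3_ind: j; elim/ord3_ind: k => //= _;
    rewrite !mxE /= !u !z; ring.
have [b0 c0] : B i k = 0 /\ B j k = 0.
  apply: (eq0_of_normsq aa); apply: eq_of_double_diff h _; move: ijk {d aa}.
  elim/ord3_ind: i; elim/ord3_ind: j; elim/ord3_ind: k => //= _;
    rewrite !mxE /= !u !z; ring.
split=> //; apply/matrixP => p q; rewrite !mxE.
have mem r : r \in [:: i; j; k].
  move: ijk {h d aa b0 c0}.
  elim/ord3_ind: i; elim/ord3_ind: j; elim/ord3_ind: k => //= _;
    by elim/ord3_ind: r.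
move: (mem p) (mem q) ijk; rewrite !inE.
move=> /or3P[] /eqP -> /or3P[] /eqP -> /=; rewrite !inE negb_or andbT.
all: move=> /andP[/andP[ij ik] jk]; rewrite ?z ?(s i) ?(s j k) ?b0 ?c0.
all: rewrite ?eqxx ?(eq_sym j i) ?(eq_sym k).
all: rewrite ?(negbTE ij) ?(negbTE ik) ?(negbTE jk) /=.
all: by rewrite ?addr0 ?add0r ?mulr0 ?mulr1.
Qed.

Lemma sym_aut_fix_diag (g : {linear 'M[C]_3 -> 'M[C]_3}) :
  (forall X, X^T = X -> (g X)^T = g X) ->
  (forall X, X^T = X -> \det (g X) = \det X) ->
  (forall X Y, X^T = X -> Y^T = Y -> hermx (g X) (g Y) = hermx X Y) ->
  (forall k, g (delta_mx k k) = delta_mx k k) ->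
  exists2 d : 'rV[C]_3, (forall k, d 0 k = 1 \/ d 0 k = -1) &
    forall X, X^T = X -> g X = diag_mx d *m X *m diag_mx d.
Proof.
move=> gs gd gh gk.
(* The form against the fixed [delta_mx k k] reads off a diagonal entry, so [g] preserves
   diagonals. *)
have diag0 i j k : i != j -> g (sym_unit i j) k k = 0.
  move=> ij; rewrite -hermx_delta -{1}gk gh ?trmx_delta ?sym_unitT //.
  rewrite hermx_delta !mxE.
  case: (eqVneq k i) => [->|_]; rewrite ?(negbTE ij) ?addr0 //=.
  by rewrite andbF addr0.
have det2 i j k : \det (delta_mx k k + g (sym_unit i j)) +
     \det (delta_mx k k - g (sym_unit i j)) =
     \det (delta_mx k k + sym_unit i j) + \det (delta_mx k k - sym_unit i j).
  rewrite -[in LHS](gk k) -raddfD -raddfB !gd //.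
    by rewrite raddfB /= trmx_delta sym_unitT.
  by rewrite raddfD /= trmx_delta sym_unitT.
have unit i j k : uniq [:: i; j; k] -> g (sym_unit i j) i j ^+ 2 = 1 /\
    g (sym_unit i j) = g (sym_unit i j) i j *: sym_unit i j.
  move=> ijk; apply: sym_unit_char (ijk) _ _ _ (det2 i j k).
  - by rewrite gs ?sym_unitT.
  - move=> p; apply: diag0; move: ijk.
    by rewrite /= !inE negb_or => /and3P[/andP[]].
  - by rewrite gh ?sym_unitT.
have [a1 ga] := unit o0 o1 o2 isT.
have [b1 gb] := unit o0 o2 o1 isT.
have [c1 gc] := unit o1 o2 o0 isT.
move: (g (sym_unit o0 o1) _ _) (g (sym_unit o0 o2) _ _)
  (g (sym_unit o1 o2) _ _) a1 b1 c1 ga gb gc => a b c a1 b1 c1 ga gb gc.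
(* A symmetric matrix with zero diagonal has determinant twice the product of its entries above the
   diagonal. *)
have abc : a * b * c = 1.
  pose X : 'M[C]_3 := sym_unit o0 o1 + sym_unit o0 o2 + sym_unit o1 o2.
  have T : X^T = X by rewrite 2!raddfD /= !sym_unitT.
  have := gd _ T; rewrite 2!raddfD /= ga gb gc => h.
  by apply: eq_of_double_diff h _; rewrite !det3E !mxE /=; ring.
have cab : c = a * b by rewrite -[c]mul1r -abc -mulrA -expr2 c1 mulr1.
have pm (x : C) : x ^+ 2 = 1 -> x = 1 \/ x = -1.
  by move/eqP; rewrite sqrf_eq1 => /orP[] /eqP; [left|right].
(* Conjugation by [diag(1, a, b)] scales the entries above the diagonal by [a], [b] and [a * b = c],
   and the diagonal by squares of signs. *)
exists (\row_k [:: 1; a; b]`_k).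
  by apply: ord3_ind; rewrite mxE /=; [left|apply: pm|apply: pm].
move=> X Xs; have t i j : X j i = X i j by rewrite -{1}Xs mxE.
rewrite {1}(sym_expand Xs) 3!raddfD /= raddf_sum /=.
rewrite !linearZ /= ga gb gc.
under eq_bigr do rewrite linearZ /= gk.
rewrite mul_diag_mx mul_mx_diag sum3E; apply/matrixP.
elim/ord3_ind; elim/ord3_ind; rewrite !mxE /=.
all: rewrite ?(t o0 o1) ?(t o0 o2) ?(t o1 o2) ?cab; ring: a1 b1.
Qed.

Lemma unitarymx_adjoint n (U : 'M[C]_n) : U \is unitarymx ->
  map_mx Num.conj U^T *m U = 1%:M.
Proof. by move=> /unitarymxP; exact: mulmx1C. Qed.

Lemma hermx_congr n (U X Y : 'M[C]_n) : U \is unitarymx ->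
  hermx (U *m X *m U^T) (U *m Y *m U^T) = hermx X Y.
Proof.
move=> /unitarymx_adjoint UU; rewrite /hermx !map_mxM mxtrace_mulC.
have UU' : U^T *m map_mx Num.conj U = 1%:M.
  by rewrite -[LHS]trmxK trmx_mul trmxK map_trmx UU trmx1.
rewrite -!mulmxA (mulmxA U^T) UU' mul1mx mxtrace_mulC !mulmxA.
by rewrite -mulmxA UU mulmx1 mxtrace_mulC.
Qed.

(** Cyclicity of the trace leaves the square of a scalar, so orthonormality of the matrices passes
    to the vectors up to a sign. *)
Lemma hermx_rank1 n (a b : 'cV[C]_n) :
  hermx (a *m a^T) (b *m b^T) = ((map_mx Num.conj a)^T *m b) 0 0 ^+ 2.
Proof.
rewrite /hermx map_mxM -map_trmx.
rewrite -!mulmxA mxtrace_mulC !mulmxA -(mulmxA _ b^T).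
rewrite -[b^T *m _]trmxK trmx_mul trmxK.
by rewrite /mxtrace big_ord1 mxE big_ord1 [(_^T) 0 0]mxE expr2.
Qed.

Lemma sym_aut_congr (f : {linear 'M[C]_3 -> 'M[C]_3}) :
  (forall X, X^T = X -> (f X)^T = f X) ->
  (forall X, X^T = X -> \det (f X) = \det X) ->
  (forall X Y, X^T = X -> Y^T = Y -> hermx (f X) (f Y) = hermx X Y) ->
  (forall W, W^T = W -> exists2 V, V^T = V & W = f V) ->
  exists A : 'M[C]_3, [/\ A \is unitarymx, \det A = 1 &
    forall X, X^T = X -> f X = A *m X *m A^T].
Proof.
move=> fs fd fh fsurj.
have dT i : (delta_mx i i)^T = delta_mx i i :> 'M[C]_3 by rewrite trmx_delta.
have rank1 i : exists a : 'cV[C]_3, f (delta_mx i i) = a *m a^T.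
  apply: sym_rank1; first exact: fs.
  apply: polar_det_minor; first exact: fs.
  (* Writing the test matrix as [f V] lets invariance of the determinant carry the second difference
     back to [delta_mx i i]. *)
  move=> _ /fsurj[V VT ->].
  by rewrite -raddfD -raddfB !fd ?polar_det_diag // ?raddfD ?raddfN /= ?VT ?dT.
have [a aE] := fin_all_exists rank1.
pose A : 'M[C]_3 := \matrix_(i, j) a j i 0.
have AA : map_mx Num.conj A^T *m A = 1%:M.
  apply/matrixP => i j; rewrite !mxE.
  pose t := ((map_mx Num.conj (a i))^T *m a j) 0 0.
  rewrite (_ : \sum_k _ = t); last first.
    by rewrite /t mxE; apply: eq_bigr => k _; rewrite !mxE.
  have t2 : t ^+ 2 = (i == j)%:R.
    by rewrite -hermx_rank1 -!aE fh // hermx_delta mxE andbb.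
  have [ij|ij] := eqVneq i j; last first.
    by move: t2; rewrite (negbTE ij) => /eqP; rewrite expf_eq0 => /eqP.
  (* Positivity of the inner product of [a i] with itself selects the root [1] of [t ^+ 2 = 1]. *)
  have t0 : 0 <= t.
    rewrite /t -ij mxE; apply: sumr_ge0 => k _.
    by rewrite !mxE mulrC mul_conjC_ge0.
  by apply/eqP; rewrite -(@eqrXn2 _ 2) ?ler01 // t2 ij eqxx expr1n.
have Au : A \is unitarymx by apply/unitarymxP; exact: mulmx1C AA.
pose U : 'M[C]_3 := map_mx Num.conj A^T.
have UA : U *m A = 1%:M by [].
have AU : A *m U = 1%:M by exact: mulmx1C.
have UAT : A^T *m U^T = 1%:M by rewrite -trmx_mul UA trmx1.
have AUT : U^T *m A^T = 1%:M by rewrite -trmx_mul AU trmx1.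
have Uu : U \is unitarymx by rewrite trmxC_unitary.
pose g := (mulmxr U^T \o (mulmx U \o f)) : {linear 'M[C]_3 -> 'M[C]_3}.
have gE X : g X = U *m f X *m U^T by [].
have fg X : f X = A *m g X *m A^T.
  by rewrite gE !mulmxA AU mul1mx -mulmxA AUT mulmx1.
(* Summing the rank-one images gives [f 1 = A *m A^T], of determinant [1]. *)
have detA : \det A ^+ 2 = 1.
  rewrite expr2 -{2}det_tr -det_mulmx.
  rewrite -(det1 C 3) -[in RHS](fd 1%:M) ?trmx1 //; congr (\det _).
  rewrite mx1_sum_delta raddf_sum /=; apply/matrixP => i j.
  rewrite summxE mxE; apply: eq_bigr => k _.
  by rewrite aE !mxE big_ord1 !mxE.
have gk k : g (delta_mx k k) = delta_mx k k.
  have aA : a k = A *m delta_mx k 0.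
    by rewrite -colE; apply/colP => i; rewrite !mxE.
  rewrite gE aE aA trmx_mul !mulmxA UA mul1mx -mulmxA UAT mulmx1.
  by rewrite trmx_delta mul_delta_mx.
have [|||d d1 gd] := sym_aut_fix_diag _ _ _ gk.
- by move=> X XT; rewrite gE !trmx_mul trmxK fs // mulmxA.
- move=> X XT; rewrite gE !det_mulmx fd // det_tr mulrAC -expr2.
  rewrite -[RHS]mul1r; congr (_ * _).
  by rewrite -[LHS]mulr1 -detA -exprMn -det_mulmx UA det1 expr1n.
- by move=> X Y XT YT; rewrite !gE hermx_congr // fh.
have d2 k : d 0 k * d 0 k = 1 by case: (d1 k) => ->; rewrite ?mulrNN mulr1.
have dc k : (d 0 k)^* = d 0 k.
  by case: (d1 k) => ->; rewrite (rmorphN1, rmorph1).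
(* Since [s] is a sign, [s *: P] induces the same congruence as [P] and has determinant
   [s ^+ 3 * s = 1]. *)
pose P := A *m diag_mx d; pose s := \det P.
have s2 : s * s = 1.
  rewrite /s det_mulmx mulrACA -!expr2 detA mul1r det_diag -prodrXl.
  by apply: big1 => k _; rewrite expr2 d2.
have sc : s^* = s.
  have : s ^+ 2 == 1 by rewrite expr2 s2.
  by rewrite sqrf_eq1 => /orP[] /eqP ->; rewrite (rmorphN1, rmorph1).
have PP : P *m map_mx Num.conj P^T = 1%:M.
  rewrite trmx_mul tr_diag_mx map_mxM map_diag_mx -mulmxA (mulmxA (diag_mx d)).
  rewrite (_ : diag_mx d *m _ = 1%:M) ?mul1mx //.
  rewrite mulmx_diag -diag_const_mx; congr diag_mx.
  by apply/rowP => k; rewrite !mxE /= dc d2.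
exists (s *: P); split.
- apply/unitarymxP; rewrite linearZ /= map_mxZ /= sc -scalemxAl -scalemxAr.
  by rewrite scalerA s2 scale1r.
- by rewrite detZ -/s !exprS expr0 mulr1 -!mulrA s2 mulr1 s2.
move=> X XT; rewrite fg gd // linearZ /= -!scalemxAl -scalemxAr scalerA s2.
by rewrite scale1r /P trmx_mul tr_diag_mx !mulmxA.
Qed.
End SymmetricAutomorphisms.

Local Open Scope classical_set_scope.

(** * Real polynomial maps and their smoothness *)

Section Polynomial.
Variable R : realType.
Local Notation C := R[i].

Inductive polyfun m : ('rV[R]_m -> R) -> Prop :=
| polyfun_cst c : polyfun (cst c)
| polyfun_coord j : polyfun (fun w => w 0 j)
| polyfunD f g : polyfun f -> polyfun g -> polyfun (f + g)
| polyfunM f g : polyfun f -> polyfun g -> polyfun (f * g).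

Lemma polyfun_continuous m (f : 'rV[R]_m -> R) : polyfun f -> continuous f.
Proof.
elim=> [c|j|{}f g _ cf _ cg|{}f g _ cf _ cg] x.
- exact: cst_continuous.
- exact: coord_continuous.
- exact: cvgD (cf x) (cg x).
- exact: cvgM (cf x) (cg x).
Qed.

Lemma derivable_rV_coord m (j : 'I_m) (x v : 'rV[R]_m) :
  derivable (fun w : 'rV[R]_m => w 0 j) x v.
Proof. exact: (derivable_mxP id x v).1 (@derivable_id _ _ _ _) 0 j. Qed.

Lemma derive_rV_coord m (j : 'I_m) (v : 'rV[R]_m) :
  'D_v (fun w : 'rV[R]_m => w 0 j) = cst (v 0 j).
Proof.
apply/funext => x; have := derive_mx (@derivable_id _ _ x v).
by rewrite derive_id => /rowP /(_ j); rewrite mxE.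
Qed.

(** Both claims go through one induction because the product rule needs differentiable factors. *)
Lemma polyfun_derive m (f : 'rV[R]_m -> R) v : polyfun f ->
  (forall x, derivable f x v) /\ polyfun ('D_v f).
Proof.
elim=> [c|j|{}f g pf [df pdf] pg [dg pdg]|{}f g pf [df pdf] pg [dg pdg]].
- split=> [x|]; first exact: derivable_cst.
  rewrite (_ : 'D_v _ = cst 0); first exact: polyfun_cst.
  by apply/funext => x; exact: derive_cst.
- split=> [x|]; first exact: derivable_rV_coord.
  by rewrite derive_rV_coord; exact: polyfun_cst.
- split=> [x|]; first exact: derivableD.
  rewrite (_ : 'D_v _ = 'D_v f + 'D_v g); first exact: polyfunD.
  by apply/funext => x; exact: deriveD.
- split=> [x|]; first exact: derivableM.
  rewrite (_ : 'D_v _ = f * 'D_v g + g * 'D_v f).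
    by apply: polyfunD; exact: polyfunM.
  by apply/funext => x; exact: deriveM.
Qed.

Lemma continuous_rV m n (f : 'rV[R]_m -> 'rV[R]_n) :
  (forall j, continuous (fun w => f w 0 j)) -> continuous f.
Proof.
move=> cf x; apply/(@cvgrPdist_le _ _ _ (nbhs x) (nbhs_filter x)) => /= e e0.
near=> y.
rewrite [leLHS]/Num.Def.normr/= mx_normrE (bigmax_le _ (ltW e0))//= => i _.
rewrite !mxE/= (ord1 i.1).
move: i; near: y; apply: (filter_forall (nbhs_filter x)) => /= i.
exact: ((cvgrPdist_le _ _).1 (cf i.2 x)).
Unshelve. all: by end_near. Qed.

(** Derivatives are taken entrywise, so the hypothesis passes from [f] to ['D_v f] and induction on
    the order applies. *)
Lemma smooth_on_polyfun m n (f : 'rV[R]_m -> 'rV[R]_n) :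
  (forall j, polyfun (fun w => f w 0 j)) -> smooth_on setT f.
Proof.
move=> pf; split=> [|k]; first exact: openT.
elim: k f pf => [|k IH] f pf /=; split=> //; try by
  move=> x _; apply: continuous_rV => j; exact: polyfun_continuous.
move=> v; have df x : derivable f x v.
  apply/derivable_mxP => i j; rewrite (ord1 i).
  exact: (polyfun_derive v (pf j)).1.
split=> // ; apply: IH => j.
rewrite (_ : (fun w => _) = 'D_v (fun w => f w 0 j)).
  exact: (polyfun_derive v (pf j)).2.
by apply/funext => x; rewrite derive_mx // mxE.
Qed.

(** Polynomial in real coordinates: conjugation must be allowed, as the inverse map uses [tau]. *)
Definition cpolyfun m (h : 'rV[R]_m -> C) : Prop :=
  polyfun (fun w => complex.Re (h w)) /\ polyfun (fun w => complex.Im (h w)).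

Lemma cpolyfun_cst m (c : C) : cpolyfun (fun _ : 'rV[R]_m => c).
Proof. by split; exact: polyfun_cst. Qed.

Lemma polyfunN m (f : 'rV[R]_m -> R) : polyfun f -> polyfun (- f).
Proof.
move=> pf; rewrite (_ : - f = cst (-1) * f).
  by apply: polyfunM pf; exact: polyfun_cst.
by apply/funext => w; rewrite /= mulN1r.
Qed.

Lemma cpolyfunD m (h k : 'rV[R]_m -> C) :
  cpolyfun h -> cpolyfun k -> cpolyfun (fun w => h w + k w).
Proof.
move=> [h1 h2] [k1 k2]; split.
  rewrite (_ : (fun w => _) =
      (fun w => complex.Re (h w)) + (fun w => complex.Re (k w))).
    exact: polyfunD.
  by apply/funext => w; rewrite !fctE; case: (h w) => ? ?; case: (k w).
rewrite (_ : (fun w => _) =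
    (fun w => complex.Im (h w)) + (fun w => complex.Im (k w))).
  exact: polyfunD.
by apply/funext => w; rewrite !fctE; case: (h w) => ? ?; case: (k w).
Qed.

Lemma cpolyfunM m (h k : 'rV[R]_m -> C) :
  cpolyfun h -> cpolyfun k -> cpolyfun (fun w => h w * k w).
Proof.
move=> [h1 h2] [k1 k2]; split.
  rewrite (_ : (fun w => _) =
      (fun w => complex.Re (h w)) * (fun w => complex.Re (k w))
      - (fun w => complex.Im (h w)) * (fun w => complex.Im (k w))).
    by apply: polyfunD; last apply: polyfunN; exact: polyfunM.
  by apply/funext => w; rewrite !fctE; case: (h w) => ? ?; case: (k w).
rewrite (_ : (fun w => _) =
    (fun w => complex.Re (h w)) * (fun w => complex.Im (k w))
    + (fun w => complex.Im (h w)) * (fun w => complex.Re (k w))).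
  by apply: polyfunD; exact: polyfunM.
by apply/funext => w; rewrite !fctE; case: (h w) => ? ?; case: (k w).
Qed.

Lemma cpolyfun_conj m (h : 'rV[R]_m -> C) :
  cpolyfun h -> cpolyfun (fun w => (h w)^*).
Proof.
move=> [h1 h2]; split.
  rewrite (_ : (fun w => _) = (fun w => complex.Re (h w))) //.
  by apply/funext => w; case: (h w).
rewrite (_ : (fun w => _) = - (fun w => complex.Im (h w))).
  exact: polyfunN.
by apply/funext => w; rewrite !fctE; case: (h w).
Qed.

Lemma cpolyfun_sum m (I : Type) (r : seq I) (P : pred I)
    (h : I -> 'rV[R]_m -> C) :
  (forall i, cpolyfun (h i)) -> cpolyfun (fun w => \sum_(i <- r | P i) h i w).
Proof.
move=> hh; elim: r => [|a r IH].
  by under [X in cpolyfun X]funext do rewrite big_nil; apply: cpolyfun_cst.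
under [X in cpolyfun X]funext do rewrite big_cons.
by case: (P a); first apply: cpolyfunD.
Qed.

Lemma cpolyfun_linear (V : vectType C) (l : V -> C) : linear_for *%R l ->
  cpolyfun (fun w => l (@realdecode R V w)).
Proof.
move=> ll.
pose l' : {linear V -> C^o} := HB.pack (l : V -> C^o)
  (GRing.isLinear.Build C V C^o *:%R l ll).
have e w : l (@realdecode R V w) =
    \sum_j (w 0 (lshift _ j) +i* w 0 (rshift _ j))%C * l (vbasis {:V})`_j.
  rewrite -[LHS]/(l' _) /realdecode linear_sum.
  by apply: eq_bigr => j _; rewrite linearZ.
under [X in cpolyfun X]funext do rewrite e.
apply: cpolyfun_sum => j; apply: cpolyfunM; last exact: cpolyfun_cst.
by split; exact: polyfun_coord.
Qed.

(** Both maps are later written in this form. Coordinates in the chosen basis are complex-linear,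
    hence keep coefficients polynomial. *)
Lemma smooth_on_realcoord m (V : vectType C) (I : Type) (r : seq I)
    (h : I -> 'rV[R]_m -> C) (v : I -> V) : (forall i, cpolyfun (h i)) ->
  smooth_on setT (fun w => @realcoord R V (\sum_(i <- r) h i w *: v i)).
Proof.
move=> ph; apply: smooth_on_polyfun => j.
have pc k :
  cpolyfun (fun w => coord (vbasis {:V}) k (\sum_(i <- r) h i w *: v i)).
  under [X in cpolyfun X]funext do rewrite linear_sum /=.
  apply: cpolyfun_sum => i.
  under [X in cpolyfun X]funext do rewrite linearZ /=.
  by apply: cpolyfunM => //; exact: cpolyfun_cst.
rewrite -(splitK j); case: (fintype.split j) => k /=.
  under [X in polyfun X]funext do rewrite row_mxEl mxE.
  exact: (pc k).1.
under [X in polyfun X]funext do rewrite row_mxEr mxE.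
exact: (pc k).2.
Qed.

End Polynomial.

(** * Axial vectors under congruence *)

Definition next3 (q : 'I_3) : 'I_3 := nth o0 [:: o1; o2; o0] q.

Definition axial (K : nzRingType) (W : 'M[K]_3) : 'cV[K]_3 :=
  \col_p (W (next3 p) (next3 (next3 p)) - W (next3 (next3 p)) (next3 p)).

(** Congruence acts on antisymmetric parts through the exterior square of [M], which is its cofactor
    matrix; [M^T] times that matrix is [\det M]. *)
Lemma axial_congr (K : comNzRingType) (M W : 'M[K]_3) :
  M^T *m axial (M *m W *m M^T) = \det M *: axial W.
Proof.
apply/colP; elim/ord3_ind; rewrite det3E.
all: do ![rewrite mxE | rewrite sum3E | rewrite /=]; ring.
Qed.

Lemma axial_delta (K : nzRingType) (q : 'I_3) :
  axial (delta_mx (next3 q) (next3 (next3 q))) = delta_mx q 0 :> 'cV[K]_3.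
Proof.
apply/colP; elim/ord3_ind: q; elim/ord3_ind; rewrite !mxE /=.
all: by rewrite ?subr0 ?subrr.
Qed.

(** For unitary [A] take [B = tau A]: conjugating the outer factors makes the product of three
    congruences telescope. *)
Lemma congr_mulmx (K : comNzRingType) n (A B Y Z : 'M[K]_n) :
  B^T *m A = 1%:M -> A^T *m B = 1%:M ->
  (B *m Y *m B^T) *m (A *m A^T) *m (B *m Z *m B^T) = B *m (Y *m Z) *m B^T.
Proof.
move=> BA AB; rewrite !mulmxA -(mulmxA _ B^T A) BA mulmx1.
by rewrite -(mulmxA _ A^T B) AB mulmx1.
Qed.

(** * Congruence by SU(3) and the inverse homomorphism *)

Section Main.
Variable R : realType.
Local Notation C := R[i].
Local Notation JRC := (JRC R).
Local Notation symproj := (vsproj (symmx R)).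

Lemma symprojK (X : 'M[C]_3) : X^T = X -> vsval (symproj X) = X.
Proof. by move=> XT; rewrite vsprojK // mem_symmx XT. Qed.

Lemma vsval_tr (X : JRC) : (vsval X)^T = vsval X.
Proof. by apply/eqP; rewrite -mem_symmx; exact: subvsP. Qed.

Lemma hermE (X Y : JRC) : herm X Y = hermx (vsval X) (vsval Y).
Proof.
rewrite /herm /trform /jordan /hermx mxtraceZ raddfD /=.
rewrite [X in _ + X]mxtrace_mulC.
by rewrite -mulr2n -[X in _ * X]mulr_natl mulKf // pnatr_eq0.
Qed.

(** Two independent matrices make this bilinear, as [congr_lfunE] needs; [symproj] is there because
    [A X B^T] need not be symmetric when [A] and [B] differ. *)
Definition congr_lfun (A B : 'M[C]_3) : 'End(JRC) :=
  linfun (symproj \o (mulmxr B^T \o (mulmx A \o vsval))).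

Lemma vsval_congr_lfun A X :
  vsval (congr_lfun A A X) = A *m vsval X *m A^T.
Proof.
by rewrite lfunE /= symprojK // !trmx_mul trmxK vsval_tr mulmxA.
Qed.

Fact congr_lfun_ker (A : SU_sort R 3) : lker (congr_lfun A A) == 0%VS.
Proof.
apply/lker0P => X Y /(congr1 vsval); rewrite !vsval_congr_lfun => XY.
apply: val_inj => /=.
have AT : (A : 'M[C]_3)^T \in unitmx by rewrite unitmx_tr SU_unit.
exact: (can_inj (mulKmx (SU_unit A)) (can_inj (mulmxK AT) XY)).
Qed.

Definition SU_congr_aut (A : SU_sort R 3) : linaut JRC :=
  LinAut (congr_lfun_ker A).

Fact SU_congr_E6R A : E6R_pred (SU_congr_aut A).
Proof.
apply/E6RP; split=> [X|X Y]; rewrite ?hermE !vsval_congr_lfun.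
  by rewrite !det_mulmx det_tr SU_det mul1r mulr1.
by rewrite hermx_congr ?SU_unitary.
Qed.

Definition SU_to_E6R A : E6R_sort R := MkE6R (SU_congr_E6R A).

Lemma SU_to_E6RM : {morph SU_to_E6R : A B / (A * B)%g}.
Proof.
move=> A B; do 2!apply: val_inj; apply/lfunP => X; apply: val_inj.
rewrite /= comp_lfunE !vsval_congr_lfun /= trmx_mul.
by rewrite !mulmxA.
Qed.

Lemma SU_to_E6R_surj (a : E6R_sort R) : exists A, SU_to_E6R A = a.
Proof.
have /E6RP[ad ah] := valP a.
(* [sym_aut_congr] speaks of maps on all matrices; [symproj] extends [a] linearly to them. *)
pose f : {linear 'M[C]_3 -> 'M[C]_3} :=
  vsval \o ((linaut_val (val a) : JRC -> JRC) \o symproj).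
have [|||W WT|A [Au Ad Af]] := @sym_aut_congr _ f.
- by move=> X _; rewrite /= vsval_tr.
- by move=> X XT; rewrite /= ad symprojK.
- by move=> X Y XT YT; rewrite /= -hermE ah hermE !symprojK.
- exists (vsval ((linaut_val (val a))^-1%VF (symproj W))).
    exact: vsval_tr.
  by rewrite /= vsvalK (lker0_lfunVK (linaut_ker (val a))) symprojK.
have SUA : (A \is unitarymx) && (\det A == 1) by rewrite Au Ad eqxx.
exists (MkSU SUA); do 2!apply: val_inj; apply/lfunP => X; apply: val_inj.
rewrite /= vsval_congr_lfun -Af ?vsval_tr //=.
by rewrite vsvalK.
Qed.

(** Given on all of ['End(JRC)] so as to be an ambient smooth map. The two outer arguments are
    symmetric, yet their product is the matrix unit whose axial vector is basis vector [q]. *)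
Definition decode_SU (a : 'End(JRC)) : 'M[C]_3 :=
  \matrix_(p, q) axial
    (tau (vsval (a (symproj (delta_mx (next3 q) (next3 q)))))
     *m vsval (a (symproj 1%:M))
     *m tau (vsval (a (symproj (sym_unit (next3 q) (next3 (next3 q))))))) p 0.

(** This is [axial_congr] for [M = tau A], whose determinant is [1] and whose transpose is inverse
    to [A]. *)
Lemma axial_congr_SU (A : SU_sort R 3) (W : 'M[C]_3) :
  axial (tau A *m W *m (tau A)^T) = A *m axial W.
Proof.
have AA : A *m (tau A)^T = 1%:M.
  by rewrite /tau map_trmx; apply/unitarymxP; exact: SU_unitary.
rewrite -[LHS]mul1mx -AA -(mulmxA _ _ (axial _)) axial_congr.
by rewrite /tau det_map_mx SU_det rmorph1 scale1r.
Qed.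

Lemma tau_congr (A X : 'M[C]_3) :
  tau (A *m X *m A^T) = tau A *m tau X *m (tau A)^T.
Proof. by rewrite /tau !map_mxM map_trmx. Qed.

Lemma tau_delta (i j : 'I_3) : tau (delta_mx i j : 'M[C]_3) = delta_mx i j.
Proof. by rewrite /tau map_delta_mx. Qed.

Lemma decode_SUK (A : SU_sort R 3) : decode_SU (val (SU_to_E6R A)) = A.
Proof.
apply/matrixP => p q; rewrite mxE !vsval_congr_lfun.
rewrite !symprojK ?trmx1 ?trmx_delta ?sym_unitT //.
set Y := delta_mx _ _; set Z := sym_unit _ _.
have AA : (A : 'M[C]_3)^T *m tau A = 1%:M.
  rewrite -[LHS]trmxK trmx_mul trmxK /tau map_trmx.
  by rewrite unitarymx_adjoint ?SU_unitary // trmx1.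
have AA' : (tau A)^T *m A = 1%:M.
  by rewrite /tau map_trmx unitarymx_adjoint ?SU_unitary.
rewrite !tau_congr mulmx1 (congr_mulmx _ _ AA' AA).
rewrite axial_congr_SU tau_delta.
have -> : tau Z = Z by rewrite /Z /sym_unit /tau map_mxD !map_delta_mx.
(* The second summand of [Z] is killed by [Y], as [next3 q] differs from its successor. *)
rewrite /Y /Z mulmxDr mul_delta_mx mul_delta_mx_0 ?addr0; last first.
  by elim/ord3_ind: q {Y Z}.
by rewrite axial_delta -colE mxE.
Qed.

(** By surjectivity [a] comes from some [A], and decoding returns that [A]. *)
Fact decode_SU_subproof (a : E6R_sort R) :
  (decode_SU (val a) \is unitarymx) && (\det (decode_SU (val a)) == 1).
Proof.
by have [A <-] := SU_to_E6R_surj a; rewrite decode_SUK SU_unitary SU_det eqxx.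
Qed.

Definition E6R_to_SU (a : E6R_sort R) : SU_sort R 3 :=
  MkSU (decode_SU_subproof a).

Lemma SU_to_E6RK : cancel SU_to_E6R E6R_to_SU.
Proof. by move=> A; apply: val_inj; exact: decode_SUK. Qed.

Lemma E6R_to_SUK : cancel E6R_to_SU SU_to_E6R.
Proof. by move=> a; have [A <-] := SU_to_E6R_surj a; rewrite SU_to_E6RK. Qed.

Fact E6R_to_SUM : {morph E6R_to_SU : a b / (a * b)%g}.
Proof.
move=> a b; apply: (can_inj SU_to_E6RK).
by rewrite SU_to_E6RM !E6R_to_SUK.
Qed.

HB.instance Definition _ := isMultiplicative.Build _ _ E6R_to_SU E6R_to_SUM.

(** * Smoothness of both homomorphisms *)

Lemma cpolyfun_mulmx m (n p q : nat) (h : 'rV[R]_m -> 'M[C]_(n, p))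
    (k : 'rV[R]_m -> 'M[C]_(p, q)) :
  (forall i j, cpolyfun (fun w => h w i j)) ->
  (forall i j, cpolyfun (fun w => k w i j)) ->
  forall i j, cpolyfun (fun w => (h w *m k w) i j).
Proof.
move=> ph pk i j; under [X in cpolyfun X]funext do rewrite mxE.
by apply: cpolyfun_sum => l; exact: cpolyfunM.
Qed.

Lemma cpolyfun_decode_SU p q :
  cpolyfun (fun w => decode_SU (@realdecode R 'End(JRC) w) p q).
Proof.
have papp X i j : cpolyfun (fun w => vsval ((realdecode w : 'End(JRC)) X) i j).
  apply: (cpolyfun_linear (l := fun a : 'End(JRC) => vsval (a X) i j)).
  by move=> c a b; rewrite add_lfunE scale_lfunE linearP !mxE.
have ptau X i j :
  cpolyfun (fun w => tau (vsval ((realdecode w : 'End(JRC)) X)) i j).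
  by under [X in cpolyfun X]funext do rewrite mxE; exact: cpolyfun_conj.
under [X in cpolyfun X]funext do rewrite mxE mxE.
apply: cpolyfunD; first by do 2![apply: cpolyfun_mulmx => //].
under [X in cpolyfun X]funext do rewrite -mulN1r.
apply: cpolyfunM; first exact: cpolyfun_cst.
by do 2![apply: cpolyfun_mulmx => //].
Qed.

Lemma lfun_mulmxE (M : 'M[C]_3) : linfun (mulmx M) =
  \sum_(p : 'I_3 * 'I_3) M p.1 p.2 *: linfun (mulmx (delta_mx p.1 p.2))
  :> 'End('cV[C]_3).
Proof.
apply/lfunP => x; rewrite sum_lfunE lfunE /= {1}(matrix_sum_delta M).
rewrite pair_bigA mulmx_suml; apply: eq_bigr => -[i j] _ /=.
by rewrite scale_lfunE lfunE /= scalemxAl.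
Qed.

(** Bilinear expansion: the congruence is quadratic in the entries of [M] over fixed endomorphisms,
    the shape [smooth_on_realcoord] expects. *)
Lemma congr_lfunE (M : 'M[C]_3) : congr_lfun M M =
  \sum_(p : ('I_3 * 'I_3) * ('I_3 * 'I_3))
    (M p.1.1 p.1.2 * M p.2.1 p.2.2) *:
      congr_lfun (delta_mx p.1.1 p.1.2) (delta_mx p.2.1 p.2.2).
Proof.
apply/lfunP => X; rewrite sum_lfunE lfunE /=.
rewrite {1 2}(matrix_sum_delta M) !pair_bigA /=.
rewrite mulmx_suml mulmx_suml linear_sum.
rewrite -(pair_bigA _ (fun p q => ((M p.1 p.2 * M q.1 q.2) *:
      congr_lfun (delta_mx p.1 p.2) (delta_mx q.1 q.2)) X)) /=.
apply: eq_bigr => -[i j] _; rewrite linear_sum mulmx_sumr linear_sum.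
apply: eq_bigr => -[k l] _ /=; rewrite scale_lfunE lfunE /=.
by rewrite linearZ /= -!scalemxAl -scalemxAr scalerA linearZ.
Qed.

Lemma E6R_to_SU_smooth : @lie_smooth R (E6R R) (SU R 3) E6R_to_SU.
Proof.
move=> a; exists setT; exists (fun w => realcoord (\sum_(p : 'I_3 * 'I_3)
  decode_SU (@realdecode R 'End(JRC) w) p.1 p.2 *:
    (linfun (mulmx (delta_mx p.1 p.2)) : 'End('cV[C]_3)))).
split=> //.
  by apply: smooth_on_realcoord => p; exact: cpolyfun_decode_SU.
move=> b _; rewrite /lie_coord realcoordK; congr realcoord.
by rewrite -lfun_mulmxE.
Qed.

Lemma SU_to_E6R_smooth : @lie_smooth R (SU R 3) (E6R R) SU_to_E6R.
Proof.
(* Images of basis vectors recover the matrix, so its entries are linear in [u]. *)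
pose M (u : 'End('cV[C]_3)) : 'M[C]_3 := \matrix_(i, j) u (delta_mx j 0) i 0.
have MA (A : SU_sort R 3) : M (SU_rep A) = A.
  by apply/matrixP => i j; rewrite mxE /= lfunE /= -colE mxE.
have pM i j : cpolyfun (fun w => M (realdecode w) i j).
  under [X in cpolyfun X]funext do rewrite mxE.
  apply: (cpolyfun_linear (l := fun a : 'End('cV[C]_3) =>
    a (delta_mx j 0) i 0)).
  by move=> c a b; rewrite add_lfunE scale_lfunE !mxE.
move=> A; exists setT.
exists (fun w => realcoord (\sum_(p : ('I_3 * 'I_3) * ('I_3 * 'I_3))
    (M (realdecode w) p.1.1 p.1.2 * M (realdecode w) p.2.1 p.2.2) *:
      congr_lfun (delta_mx p.1.1 p.1.2) (delta_mx p.2.1 p.2.2))).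
split=> //.
  by apply: smooth_on_realcoord => p; exact: cpolyfunM.
by move=> B _; rewrite /lie_coord realcoordK MA -congr_lfunE.
Qed.

End Main.

Theorem theorem4p9 (R : realType) : lie_isomorphic (E6R R) (SU R 3).
Proof.
exists (@E6R_to_SU R), (@SU_to_E6R R); split.
- exact: E6R_to_SUK.
- exact: SU_to_E6RK.
- exact: E6R_to_SU_smooth.
- exact: SU_to_E6R_smooth.
Qed.
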